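(* Let $(X,d,\mu)$ be an irreversible metric measure space satisfying $(1,q)$-Moment concentration for $q\ge 1$ with constant $C>0$, i.e. for every $q\ge 1$ and every 1-Lipschitz function $f$ on $X$, $$\left\|f-\int_X f\,d\mu\right\|_{L^q(\mu)}\le \frac{q}{C}.$$ Then: (i) $(X,d,\mu)$ satisfies linear tail-decay when $0<r<e/C$: there is a constant $C_1>0$ such that for every 1-Lipschitz function $f$ and every $0<r<e/C$, $$\mu\left(\left\{x\in X\;\middle|\;\left|f(x)-\int_X f\,d\mu\right|\ge r\right\}\right)\le \frac{1}{C_1 r};$$ (ii) $(X,d,\mu)$ has exponential concentration when $r>e/C$: there are constants $C_2,c_2>0$ such that $\alpha_{(X,d,\mu)}(r)\le C_2e^{-c_2r}$ for every $r>e/C$.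
   Context: An irreversible metric space $(X,d)$ is a set $X$ with a function $d:X\times X\to[0,\infty)$ such that $d(x_1,x_2)=0$ if and only if $x_1=x_2$, and $d(x_1,x_3)\le d(x_1,x_2)+d(x_2,x_3)$ for all $x_1,x_2,x_3\in X$ ($d$ need not be symmetric). An irreversible metric measure space $(X,d,\mu)$ is an irreversible metric space endowed with a Borel probability measure $\mu$. For $A\subset X$ and $r>0$ put $B^{+}(A,r)=\{x\in X\mid \inf_{z\in A}d(z,x)<r\}$ and $B^{-}(A,r)=\{x\in X\mid \inf_{z\in A}d(x,z)<r\}$. The concentration function is $$\alpha_{(X,d,\mu)}(r)=\sup\left\{1-\min\{\mu(B^{+}(A,r)),\mu(B^{-}(A,r))\}\;\middle|\; A\subset X \text{ Borel},\ \mu(A)\ge \tfrac12\right\},\quad r>0.$$ A function $f:X\to\mathbb{R}$ is $L$-Lipschitz ($L>0$) if $f(z)-f(x)\le L\,d(x,z)$ for all $x,z\in X$. The sets $B^{\pm}(A,r)$ and Lipschitz functions are understood to be measurable. Here $e$ is the base of the natural logarithm. *)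

(* Defs.v *)
From HB Require Import structures.
From mathcomp Require Import all_boot all_order all_algebra.
From mathcomp Require Import all_classical all_reals all_analysis.

Set Implicit Arguments.
Unset Strict Implicit.
Unset Printing Implicit Defensive.

Import Order.TTheory GRing.Theory Num.Theory.
Import numFieldNormedType.Exports.

Local Open Scope classical_set_scope.
Local Open Scope ring_scope.

Definition irreversible_metric (R : realType) (X : Type) (d : X -> X -> R)
    : Prop :=
  [/\ forall x y, 0 <= d x y,
      forall x y, d x y = 0 <-> x = y &
      forall x y z, d x z <= d x y + d y z].

Definition forward_ball (R : realType) (X : Type) (d : X -> X -> R)
    (x : X) (r : R) : set X := [set y | d x y < r].

Definition backward_ball (R : realType) (X : Type) (d : X -> X -> R)
    (x : X) (r : R) : set X := [set y | d y x < r].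

(* For a non-symmetric d, "Borel" may refer to the topology of the forward
   balls, of the backward balls, or to their join (the topology of the
   symmetrization of d). These may differ, so everything is parameterized
   by this choice. *)
Inductive ball_topology : Set := Forward | Backward | Symmetrized.

Definition basic_ball (R : realType) (X : Type) (d : X -> X -> R)
    (k : ball_topology) (x : X) (r : R) : set X :=
  match k with
  | Forward => forward_ball d x r
  | Backward => backward_ball d x r
  | Symmetrized => forward_ball d x r `&` backward_ball d x r
  end.

(* By the triangle inequality the basic balls are themselves open in this
   sense, so this is the topology they generate. *)
Definition irr_open (R : realType) (X : Type) (d : X -> X -> R)
    (k : ball_topology) (U : set X) : Prop :=
  forall x, U x -> exists2 r : R, 0 < r & basic_ball d k x r `<=` U.

Definition borel_for (R : realType) (disp : measure_display)
    (X : measurableType disp) (d : X -> X -> R) (k : ball_topology) : Prop :=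
  @measurable disp X = <<s [set U : set X | irr_open d k U] >>.

(* The infimum is taken in \bar R, so that it is +oo when A is empty. *)
Definition Bplus (R : realType) (X : Type) (d : X -> X -> R)
    (A : set X) (r : R) : set X :=
  [set x | (ereal_inf [set (d z x)%:E | z in A] < r%:E)%E].

Definition Bminus (R : realType) (X : Type) (d : X -> X -> R)
    (A : set X) (r : R) : set X :=
  [set x | (ereal_inf [set (d x z)%:E | z in A] < r%:E)%E].

Definition lipschitz_irr (R : realType) (X : Type) (d : X -> X -> R)
    (L : R) (f : X -> R) : Prop :=
  forall x z, f z - f x <= L * d x z.

(* The measurability of Bplus and Bminus is assumed: for k = Forward, say,
   Bminus d A r need not be Borel. *)
Definition irreversible_mms (R : realType) (disp : measure_display)
    (X : measurableType disp) (d : X -> X -> R) (k : ball_topology) : Prop :=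
  [/\ irreversible_metric d,
      borel_for d k,
      forall (A : set X) (r : R), measurable A -> 0 < r ->
        measurable (Bplus d A r) /\ measurable (Bminus d A r) &
      forall (L : R) (f : X -> R), 0 < L -> lipschitz_irr d L f ->
        measurable_fun [set: X] f].

Definition concentration (R : realType) (disp : measure_display)
    (X : measurableType disp) (d : X -> X -> R) (mu : probability X R)
    (r : R) : \bar R :=
  ereal_sup [set (1 - mine (mu (Bplus d A r)) (mu (Bminus d A r)))%E
            | A in [set A : set X | measurable A /\
                                    ((2^-1 : R)%:E <= mu A)%E]].

(* [Rintegral] is total, with a junk value when f is not integrable; this is
   harmless here because the bound for q = 1 makes f - c integrable for a real
   constant c, hence f integrable. *)
Definition moment_concentration (R : realType) (disp : measure_display)
    (X : measurableType disp) (d : X -> X -> R) (mu : probability X R)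
    (C : R) : Prop :=
  forall q : R, 1 <= q -> forall f : X -> R, lipschitz_irr d 1 f ->
    ('N[mu]_(q%:E)[EFin \o (fun x => f x - \int[mu]_y f y)%R] <= (q / C)%:E)%E.

(* Main.v *)
Require Import Defs.
From mathcomp Require Import all_boot all_order all_algebra.
From mathcomp Require Import all_classical all_reals all_analysis.
From mathcomp Require Import measurable_realfun.
From mathcomp Require Import ring.

Set Implicit Arguments.
Unset Strict Implicit.
Unset Printing Implicit Defensive.

Import Order.TTheory GRing.Theory Num.Theory.
Import numFieldNormedType.Exports.

Local Open Scope classical_set_scope.
Local Open Scope ring_scope.

(** By Markov's inequality for the power [q], the moment bound gives
    [mu (|f - m| >= r) <= (q / (C r)) ^ q] for every [q >= 1], where [m] is the
    mean of [f].  The choice [q = 1] is (i); the choice [q = C r / e], allowed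
    when [r >= e / C], gives [mu (|f - m| >= r) <= exp (- C r / e)].

    For (ii), let [mu A >= 1/2] and let [f] be the distance from [A] (or minus
    the distance to [A]).  It is 1-Lipschitz and vanishes on [A], so
    [A] is contained in [|f - m| >= |m|], and (i) forces [|m| <= 2 / C].  Hence
    [|f| >= r] implies [|f - m| >= r - 2 / C], which costs only a constant
    factor in the exponential bound. *)

Lemma measurable_norm_ge (R : realType) (disp : measure_display)
    (X : measurableType disp) (f : X -> R) (r : R) :
  measurable_fun [set: X] f -> measurable [set x | r <= `|f x|].
Proof.
move=> mf; have mnf : measurable_fun [set: X] (fun x => `|f x|).
  exact: measurableT_comp.
rewrite -[X in measurable X]setTI.
have -> : [set x | r <= `|f x|] = (fun x => `|f x|) @^-1` `[r, +oo[.
  by apply/seteqP; split=> x /=; rewrite in_itv/= andbT.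
exact: mnf.
Qed.

(** Markov's inequality for the nondecreasing function [t ^ q], using that the integral of [|g| ^ q]
    is the [q]-th power of the norm. *)
Lemma markov_Lnorm (R : realType) (disp : measure_display)
    (X : measurableType disp) (mu : probability X R) (g : X -> R) (q a K : R) :
  measurable_fun [set: X] g -> 0 < q -> 0 < a -> 0 <= K ->
  ('N[mu]_(q%:E)[EFin \o g] <= K%:E)%E ->
  (mu [set x | (a <= `|g x|)%R] <= ((K / a) `^ q)%:E)%E.
Proof.
move=> mg q0 a0 K0 gK.
have /measurable_EFinP mEg := mg.
have gKq : (\int[mu]_x (`|(EFin \o g) x| `^ q) <= (K `^ q)%:E)%E.
  rewrite -poweR_Lnorm ?gt_eqF// -poweR_EFin.
  apply: gt0_ler_poweR gK; rewrite ?ltW// ?in_itv/= ?leey ?andbT//.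
  exact: Lnorm_ge0.
have := @le_integral_comp_abse _ _ _ mu setT measurableT _ a (fun x => x `^ q)%E
  (measurable_poweR _) (fun r _ => poweR_ge0 _ _) _ mEg a0.
rewrite setTI => /(_ _)/le_trans/(_ gKq) H.
have {}H := H _.
have -> : [set x | a <= `|g x|] = [set x | (a%:E <= `|(EFin \o g) x|)%E].
  by apply/seteqP; split=> x /=; rewrite lee_fin.
have aq : 0 < a `^ q by exact: powR_gt0.
rewrite powRM ?invr_ge0 ?(ltW a0)// EFinM.
rewrite -[a^-1]powR_inv1 ?(ltW a0)// powRAC powR_inv1 ?powR_ge0//.
rewrite lee_pdivlMr// muleC.
(* What remains is the monotonicity of [t ^ q] that Markov's inequality requires. *)
apply: H => x y; rewrite !inE/= !in_itv/= !andbT => x0 y0.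
by apply: gt0_ler_poweR; rewrite ?ltW// in_itv/= ?x0 ?y0 leey.
Qed.

Lemma moment_tail (R : realType) (disp : measure_display)
    (X : measurableType disp) (d : X -> X -> R) (k : ball_topology)
    (mu : probability X R) (C : R) (f : X -> R) (q r : R) :
  irreversible_mms d k -> 0 < C -> moment_concentration d mu C ->
  lipschitz_irr d 1 f -> 1 <= q -> 0 < r ->
  (mu [set x | (r <= `|f x - \int[mu]_y f y|)%R] <= ((q / C / r) `^ q)%:E)%E.
Proof.
move=> [_ _ _ mlip] C0 mom lf q1 r0.
have q0 : 0 < q by exact: lt_le_trans q1.
apply: markov_Lnorm => //.
- apply: measurable_funB; [exact: mlip lf|exact: measurable_cst].
- by rewrite divr_ge0// ltW.
- exact: mom.
Qed.

Lemma linear_tail (R : realType) (disp : measure_display)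
    (X : measurableType disp) (d : X -> X -> R) (k : ball_topology)
    (mu : probability X R) (C : R) (f : X -> R) (r : R) :
  irreversible_mms d k -> 0 < C -> moment_concentration d mu C ->
  lipschitz_irr d 1 f -> 0 < r ->
  (mu [set x | (r <= `|f x - \int[mu]_y f y|)%R] <= (1 / (C * r))%:E)%E.
Proof.
move=> hX C0 mom lf r0.
have := moment_tail hX C0 mom lf (lexx 1) r0.
rewrite powRr1; first by rewrite !div1r invfM.
by rewrite !divr_ge0 ?ltW.
Qed.

Lemma exponential_tail (R : realType) (disp : measure_display)
    (X : measurableType disp) (d : X -> X -> R) (k : ball_topology)
    (mu : probability X R) (C : R) (f : X -> R) (r : R) :
  irreversible_mms d k -> 0 < C -> moment_concentration d mu C ->
  lipschitz_irr d 1 f -> expR 1 / C <= r ->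
  (mu [set x | (r <= `|f x - \int[mu]_y f y|)%R]
    <= (expR (- (C / expR 1) * r))%:E)%E.
Proof.
move=> hX C0 mom lf er.
have e0 : 0 < expR 1 :> R by exact: expR_gt0.
have r0 : 0 < r by apply: lt_le_trans er; exact: divr_gt0.
(* The exponent [q = C r / e] minimizes [(q / (C r)) ^ q] over [q > 0] and turns the base into
   [1 / e]. *)
have q1 : 1 <= C * r / expR 1.
  by rewrite ler_pdivlMr// mul1r; rewrite ler_pdivrMr// mulrC in er.
have := moment_tail hX C0 mom lf q1 r0.
have -> : C * r / expR 1 / C / r = expR (-1).
  rewrite expRN; field.
  by rewrite !gt_eqF.
rewrite -expRM; congr (_ <= (expR _)%:E)%E.
by ring.
Qed.

(** In the constant, [exp (2 / e)] pays for the shift of [r] by [2 / C], and the extra factor [e]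
    makes the bound at least 1 where the shifted radius is below [e / C]. *)
Lemma exponential_tail_vanishing (R : realType) (disp : measure_display)
    (X : measurableType disp) (d : X -> X -> R) (k : ball_topology)
    (mu : probability X R) (C : R) (A : set X) (f : X -> R) (r : R) :
  irreversible_mms d k -> 0 < C -> moment_concentration d mu C ->
  measurable A -> ((2^-1 : R)%:E <= mu A)%E ->
  lipschitz_irr d 1 f -> (forall x, A x -> f x = 0) ->
  (mu [set x | (r <= `|f x|)%R]
    <= (expR (1 + 2 / expR 1) * expR (- (C / expR 1) * r))%:E)%E.
Proof.
move=> hX C0 mom mA A2 lf fA.
have e0 : 0 < expR 1 :> R by exact: expR_gt0.
have mf : measurable_fun [set: X] f by case: hX => _ _ _ mlip; exact: mlip lf.
have mtail (c s : R) : measurable [set x | s <= `|f x - c|].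
  apply: measurable_norm_ge.
  by apply: measurable_funB => //; exact: measurable_cst.
pose m := \int[mu]_y f y.
have mC : `|m| <= 2 / C.
  (* The linear tail is applied at radius [|m|], which has to be positive. *)
  have [->|m0] := eqVneq m 0; first by rewrite normr0 divr_ge0// ltW.
  have m0' : 0 < `|m| by rewrite normr_gt0.
  have : (2^-1%:E <= (1 / (C * `|m|))%:E :> \bar R)%E.
    apply: le_trans (linear_tail hX C0 mom lf m0').
    apply: le_trans A2 _; apply: le_measure; rewrite ?inE//.
    by move=> x Ax /=; rewrite fA// sub0r normrN.
  rewrite lee_fin div1r lef_pV2 ?posrE ?mulr_gt0// => H.
  by rewrite ler_pdivlMr// mulrC.
have sub : [set x | r <= `|f x|] `<=` [set x | r - 2 / C <= `|f x - m|].
  move=> x /= rx; rewrite lerBlDr; apply: le_trans rx _.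
  rewrite -{1}(subrK m (f x)); apply: le_trans (ler_normD _ _) _.
  by rewrite lerD2l.
have mr := measurable_norm_ge r mf.
rewrite -expRD.
have [er|er] := leP (expR 1 / C) (r - 2 / C).
  apply: (@le_trans _ _ (mu [set x | r - 2 / C <= `|f x - m|])).
    by apply: le_measure; rewrite ?inE.
  apply: le_trans (exponential_tail hX C0 mom lf er) _.
  (* The two exponents differ by exactly 1, the spare factor [e]. *)
  rewrite lee_fin ler_expR -subr_ge0.
  rewrite [leRHS](_ : _ = 1)//.
  by field; rewrite !gt_eqF.
apply: le_trans (probability_le1 mu mr) _.
rewrite lee_fin -[leLHS]expR0 ler_expR.
rewrite [leRHS](_ : _ = (C / expR 1) * (expR 1 / C - (r - 2 / C))).
  by rewrite mulr_ge0 ?subr_ge0 ?ltW// divr_gt0.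
by field; rewrite !gt_eqF.
Qed.

Section dist_to_set.
Context {R : realType} {X : Type}.
Implicit Types (d : X -> X -> R) (A : set X).

(* Applying this to [d] and to its reverse covers both [B^+] and [B^-]. *)
Definition dist_from d A (x : X) : R := inf [set d z x | z in A].

Lemma dist_from_le d A x z : (forall x y, 0 <= d x y) -> A z ->
  dist_from d A x <= d z x.
Proof.
move=> d0 Az; apply: ge_inf; last by exists z.
by exists 0 => _ [y _ <-].
Qed.

Lemma dist_from_ge0 d A x : (forall x y, 0 <= d x y) -> A !=set0 ->
  0 <= dist_from d A x.
Proof.
move=> d0 [z Az]; apply: lb_le_inf; first by exists (d z x), z.
by move=> _ [y _ <-].
Qed.

Lemma dist_from_eq0 d A x : (forall x y, 0 <= d x y) ->
  (forall x, d x x = 0) -> A x -> dist_from d A x = 0.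
Proof.
move=> d0 dxx Ax; apply/eqP; rewrite eq_le -{1}(dxx x) dist_from_le//=.
by apply: dist_from_ge0 => //; exists x.
Qed.

(** Take the infimum over [w] in [A] of [d w y <= d w x + d x y]. *)
Lemma dist_from_lip d A x y : (forall x y, 0 <= d x y) ->
  (forall x y z, d x z <= d x y + d y z) -> A !=set0 ->
  dist_from d A y <= dist_from d A x + d x y.
Proof.
move=> d0 dtri [z Az]; rewrite -lerBlDr; apply: lb_le_inf.
  by exists (d z x), z.
move=> _ [w Aw <-]; rewrite lerBlDr; apply: le_trans (dtri w x y).
exact: dist_from_le.
Qed.

(** Passes from the extended infimum in [Bplus] to the real one. Nonemptiness matters: over the
    empty set the former is [+oo], while the latter defaults to 0. *)
Lemma setC_Bplus_sub d A r : (forall x y, 0 <= d x y) -> A !=set0 ->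
  ~` Bplus d A r `<=` [set x | r <= `|dist_from d A x|].
Proof.
move=> d0 A0 x /= nB; rewrite ger0_norm ?dist_from_ge0// leNgt.
apply/negP => /inf_lt[|_ [z Az <-] zr].
  by case: A0 => z Az; exists (d z x), z.
apply: nB; rewrite /Bplus /=; apply: (@le_lt_trans _ _ (d z x)%:E).
  by apply: ereal_inf_lbound; exists z.
by rewrite lte_fin.
Qed.

End dist_to_set.

Theorem theorem3p11 (R : realType) (disp : measure_display)
    (X : measurableType disp) (d : X -> X -> R) (k : ball_topology)
    (mu : probability X R) (C : R)
    (hX : irreversible_mms d k)
    (hC : 0 < C)
    (hmom : moment_concentration d mu C) :
  (exists2 C1 : R, 0 < C1 &
     forall f : X -> R, lipschitz_irr d 1 f ->
     forall r : R, 0 < r -> r < expR 1 / C ->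
       (mu [set x | (r <= `|f x - \int[mu]_y f y|)%R] <= (1 / (C1 * r))%:E)%E)
  /\
  (exists C2 c2 : R, [/\ 0 < C2, 0 < c2 &
     forall r : R, expR 1 / C < r ->
       (concentration d mu r <= (C2 * expR (- c2 * r))%:E)%E]).
Proof.
split.
  by exists C => // f lf r r0 _; exact: linear_tail hX hC hmom lf r0.
have e0 : 0 < expR 1 :> R by exact: expR_gt0.
exists (expR (1 + 2 / expR 1)), (C / expR 1); split.
- exact: expR_gt0.
- exact: divr_gt0.
move=> r er; apply: ge_ereal_sup => _ [A [mA A2] <-].
have [[d0 deq dtri] _ mB mlip] := hX.
have dxx x : d x x = 0 by exact/deq.
have r0 : 0 < r by apply: lt_trans er; exact: divr_gt0.
have A0 : A !=set0.
  apply/set0P/eqP => A0; move: A2.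
  by rewrite A0 measure0 lee_fin leNgt invr_gt0 ltr0n.
(* Serves both neighbourhoods of [A], since the minimum in the concentration function is one of
   their two measures. *)
have tail (f : X -> R) (B : set X) : lipschitz_irr d 1 f ->
    (forall x, A x -> f x = 0) -> measurable B ->
    ~` B `<=` [set x | r <= `|f x|] ->
    (1 - mu B <= (expR (1 + 2 / expR 1) * expR (- (C / expR 1) * r))%:E)%E.
  move=> lf fA mB' sub; rewrite -probability_setC//.
  apply: le_trans (exponential_tail_vanishing r hX hC hmom mA A2 lf fA).
  apply: le_measure; rewrite ?inE//; first exact: measurableC.
  by apply: measurable_norm_ge; exact: mlip lf.
have [mBp mBm] := mB A r mA r0.
rewrite /mine; case: ifPn => _.
  apply: (tail (dist_from d A)) => //.
  - by move=> x z; rewrite mul1r lerBlDl; exact: dist_from_lip.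
  - by move=> x Ax; exact: dist_from_eq0.
  - exact: setC_Bplus_sub.
(* By definition, [Bminus d A r] is [Bplus d' A r]. *)
pose d' x y := d y x.
have d'0 x y : 0 <= d' x y by exact: d0.
have d'tri x y z : d' x z <= d' x y + d' y z by rewrite addrC; exact: dtri.
(* The distance to [A] drops by at most [d x z] from [x] to [z], so it is its negative that is
   1-Lipschitz for [d]. *)
apply: (tail (fun x => - dist_from d' A x)) => //.
- move=> x z; rewrite mul1r/= (opprK (dist_from d' A x)) addrC lerBlDl.
  exact: (dist_from_lip (d := d')).
- by move=> x Ax; rewrite dist_from_eq0 ?oppr0.
- move=> x nB; rewrite /= normrN; exact: (setC_Bplus_sub (d := d')).
Qed.
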